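(* Let $p$ be a prime, $\alpha\ge 1$ an integer and $N=p^\alpha$. Let $D\subset\mathbb{Z}_{\ge 0}$ be a nonempty finite set whose elements lie in pairwise different residue classes modulo $N$, let $\mu=\mu_{N,D}$ be the associated Cantor measure, and let $T=\{t>0:\Phi_{p^t}\mid P_D\}$, where $P_D(x)=\sum_{d\in D}x^d$. Assume $P_D=\prod_{t\in T}\Phi_{p^t}$. Let $\Lambda\subset\mathbb{R}$ be an orthogonal maximal set of frequencies for $\mu$ with $0\in\Lambda$. Let $n\ge 0$ and let $(d_j)_{j=0}^{n-1}$ be integers with $0\le d_j<N$ such that $\Lambda_n(d_0,\dots,d_{n-1})\neq\emptyset$. Then $$|\{d_n(\lambda):\lambda\in\Lambda_n(d_0,\dots,d_{n-1})\}|=|D|.$$ Moreover, if $L=\{d_n(\lambda):\lambda\in\Lambda_n(d_0,\dots,d_{n-1})\}$, then $(N,D,L)$ is a Hadamard triple.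
   Context: Cantor measure: $\mu=\mu_{N,D}$ is the unique Borel probability measure on $\mathbb{R}$ satisfying $\mu=\frac{1}{|D|}\sum_{d\in D}\mu\circ\phi_d^{-1}$, where $\phi_d(x)=N^{-1}(x+d)$. Cyclotomic polynomials: $\Phi_n$ denotes the $n$-th cyclotomic polynomial. $T$ is the set of positive integers $t$ such that $\Phi_{p^t}$ divides $P_D$. Exponentials: $e_\lambda(x)=e^{2\pi i\lambda x}$ and $E(\Lambda)=\{e_\lambda:\lambda\in\Lambda\}$. ''$E(\Lambda)$ is orthogonal in $L^2(\mu)$'' means $\int e_\lambda\overline{e_{\lambda'}}\,d\mu=0$ for all $\lambda\ne\lambda'$ in $\Lambda$. Maximality: $\Lambda\subset\mathbb{R}$ is an orthogonal maximal set of frequencies for $\mu$ if $E(\Lambda)$ is orthogonal in $L^2(\mu)$ and for every $\Lambda'\subset\mathbb{R}$ with $\Lambda\subset\Lambda'$ and $E(\Lambda')$ orthogonal in $L^2(\mu)$ one has $\Lambda'=\Lambda$. Base-$N$ digits: for $k\in\mathbb{Z}$ the sequence $(d_n(k))_{n\ge0}$ with $0\le d_n(k)<N$ is defined by $k_0=k$ and $k_n=d_n(k)+Nk_{n+1}$ with $k_{n+1}\in\mathbb{Z}$, for $n\ge 0$. (It is eventually $0$ if $k\ge 0$ and eventually $N-1$ if $k<0$.) For $n\ge0$ and integers $0\le d_0,\dots,d_{n-1}<N$: $\Lambda_n(d_0,\dots,d_{n-1})=\{\lambda\in\Lambda\cap\mathbb{Z}: d_j(\lambda)=d_j\ \text{for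 all}\ 0\le j<n\}$; for $n=0$, $\Lambda_0=\Lambda\cap\mathbb{Z}$. $|A|$ is the number of elements of a finite set $A$. Hadamard triple: for finite sets $A,B\subset\mathbb{Z}$ with $|A|=|B|$, $(N,A,B)$ is a Hadamard triple if the matrix $\frac{1}{\sqrt{|A|}}\left(e^{2\pi i ab/N}\right)_{a\in A,\,b\in B}$ is unitary. *)

(* Defs.v *)
From HB Require Import structures.
From mathcomp Require Import all_boot all_order all_algebra.
From mathcomp Require Import finmap.
From mathcomp Require Import cyclotomic.
From mathcomp Require Import all_classical all_reals all_analysis.
From mathcomp Require Import complex.

Set Implicit Arguments.
Unset Strict Implicit.
Unset Printing Implicit Defensive.

Import Order.TTheory GRing.Theory Num.Theory.
Import numFieldNormedType.Exports.

Local Open Scope classical_set_scope.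
Local Open Scope ring_scope.
Local Open Scope complex_scope.

Definition phi (R : realType) (N d : nat) (x : R) : R := N%:R^-1 * (x + d%:R).

(* For N >= 2 and D nonempty exactly one probability measure satisfies this. *)
Definition is_cantor_measure (R : realType) (N : nat) (D : {fset nat})
    (mu : probability (measurableTypeR R) R) : Prop :=
  forall A : set (measurableTypeR R), measurable A ->
    mu A = (((#|` D|)%:R^-1)%:E
            * \sum_(d <- D)
                pushforward mu
                  (phi N d : measurableTypeR R -> measurableTypeR R) A)%E.

Definition mask_poly (D : {fset nat}) : {poly int} := \sum_(d <- D) 'X^d.

(* %| is pseudo-divisibility over int; it is divisibility in Z[X] because
   cyclotomic polynomials are monic. *)
Definition cyclotomic_exponents (p : nat) (D : {fset nat}) : set nat :=
  [set t | (0 < t)%N /\ 'Phi_(p ^ t) %| mask_poly D].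

Definition expi (R : realType) (x : R) : R[i] := cos x +i* sin x.

Definition efun (R : realType) (lambda x : R) : R[i] :=
  expi (2 * pi * lambda * x).

Definition Cintegral (R : realType) (mu : probability (measurableTypeR R) R)
    (f : R -> R[i]) : R[i] :=
  (\int[mu]_x complex.Re (f x)) +i* (\int[mu]_x complex.Im (f x)).

Definition orthogonal_exponentials (R : realType)
    (mu : probability (measurableTypeR R) R) (Lambda : set R) : Prop :=
  forall l l' : R, Lambda l -> Lambda l' -> l <> l' ->
    Cintegral mu (fun x => efun l x * (efun l' x)^*) = 0.

Definition orthogonal_maximal (R : realType)
    (mu : probability (measurableTypeR R) R) (Lambda : set R) : Prop :=
  orthogonal_exponentials mu Lambda /\
  forall Lambda' : set R, Lambda `<=` Lambda' ->
    orthogonal_exponentials mu Lambda' -> Lambda' = Lambda.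

Definition base_tail (N n : nat) (k : int) : int :=
  iter n (fun m => (m %/ N%:Z)%Z) k.

Definition digit (N n : nat) (k : int) : int := (base_tail N n k %% N%:Z)%Z.

Lemma base_tail0 (N : nat) (k : int) : base_tail N 0 k = k.
Proof. by []. Qed.

Lemma base_tailE (N n : nat) (k : int) :
  base_tail N n k = digit N n k + N%:Z * base_tail N n.+1 k.
Proof. by rewrite /= addrC mulrC -divz_eq. Qed.

Lemma digit_bounds (N n : nat) (k : int) : (0 < N)%N ->
  0 <= digit N n k < N%:Z.
Proof. by move=> N0; rewrite modz_ge0 ?ltz_pmod// -lt0n. Qed.

Definition frequencies_with_digits (R : realType) (N : nat) (Lambda : set R)
    (n : nat) (d : 'I_n -> int) : set int :=
  [set k | Lambda k%:~R /\ forall j : 'I_n, digit N j k = d j].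

Definition hadamard_matrix (R : realType) (N : nat) (A B : {fset int}) :
    'M[R[i]]_(#|` A|, #|` B|) :=
  ((Num.sqrt (#|` A|)%:R)^-1)%:C *:
  \matrix_(j < #|` A|, k < #|` B|)
    expi (2 * pi * (nth 0 A j * nth 0 B k)%:~R / N%:R : R).

(* unitarymx alone only says that the rows are orthonormal; with equal
   cardinals the matrix is square. *)
Definition hadamard_triple (R : realType) (N : nat) (A B : {fset int}) : Prop :=
  #|` A| = #|` B| /\ hadamard_matrix R N A B \is unitarymx.

(* Main.v *)
(* The Fourier transform of mu at xi is a multiple of its value at xi / N by
   the mask P_D(e^(2 pi i xi / N)), and it tends to 1 along xi / N^k; so it
   vanishes exactly when P_D vanishes at some e^(2 pi i xi / N^k). As P_D is a
   product of cyclotomic polynomials Phi_(p^t) and all t are at most alpha,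
   orthogonality of two frequencies becomes a condition on the p-adic valuation
   of their difference, which has to lie in a set V of exponents periodic modulo
   alpha. Hence, in the tree of base-p expansions of a maximal Lambda, every node
   branches fully at the levels of V and not at all at the others, and each
   base-N digit takes p^|T| = P_D(1) = |D| values. The same valuation condition
   gives orthogonality of the columns of the matrix of (N, D, L). *)

Require Import Defs.
From HB Require Import structures.
From mathcomp Require Import all_boot all_order all_algebra.
From mathcomp Require Import finmap.
From mathcomp Require Import cyclotomic.
From mathcomp Require Import all_classical all_reals all_analysis.
From mathcomp Require Import complex.
From mathcomp Require Import measurable_realfun ring lra.

Set Implicit Arguments.
Unset Strict Implicit.
Unset Printing Implicit Defensive.

Import Order.TTheory GRing.Theory Num.Theory.
Import numFieldNormedType.Exports.

Local Open Scope classical_set_scope.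
Local Open Scope ring_scope.

(** * Integration against the Cantor measure *)

Lemma measurable_phi (R : realType) (N d : nat) :
  measurable_fun setT (phi N d : measurableTypeR R -> measurableTypeR R).
Proof.
by apply: measurable_funM => //; apply: measurable_funD.
Qed.

Lemma bounded_integrable (R : realType)
    (mu : probability (measurableTypeR R) R) (f : measurableTypeR R -> R) :
  measurable_fun setT f -> (forall x, `|f x| <= 1) ->
  mu.-integrable setT (EFin \o f).
Proof.
move=> mf f1; apply: measurable_bounded_integrable => //.
  by apply: le_lt_trans (probability_le1 mu measurableT) _; rewrite ltry.
by exists 1; split => // M M1 x _; exact: le_trans (f1 x) (ltW M1).
Qed.

(** Self-similarity says that [mu] is a scaled finite sum of pushforwards; integration is linear in
    the measure, and each pushforward becomes a change of variables. *)
Lemma ge0_integral_cantor (R : realType) (N : nat) (D : {fset nat})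
    (mu : probability (measurableTypeR R) R) (g : measurableTypeR R -> \bar R) :
  is_cantor_measure N D mu -> measurable_fun setT g ->
  (forall x, (0 <= g x)%E) ->
  (\int[mu]_x g x =
   ((#|` D|)%:R^-1)%:E * \sum_(d <- D) \int[mu]_x g (phi N d x))%E.
Proof.
move=> muD mg g0.
have k0 : 0 <= (#|` D|)%:R^-1 :> R by [].
pose pushphi i : {measure set (measurableTypeR R) -> \bar R} :=
  pushforward mu
    (phi N (nth 0%N D i) : measurableTypeR R -> measurableTypeR R).
pose m := pushphi (fun i => measurable_phi N _).
rewrite (eq_measure_integral (mscale (NngNum k0) (msum m #|` D|))); last first.
  move=> A mA _; rewrite [LHS](muD A mA) /mscale/= /msum; congr (_ * _)%E.
  by rewrite (big_nth 0%N) big_mkord.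
rewrite ge0_integral_mscale//=; congr (_ * _)%E.
rewrite ge0_integral_measure_sum// (big_nth 0%N) big_mkord.
apply: eq_bigr => i _.
by rewrite ge0_integral_pushforward// ?preimage_setT//; exact: measurable_phi.
Qed.

(** The bound on [f] makes [1 + f] nonnegative, so the nonnegative case applies to it; the constant
    1 averages to 1 and cancels. *)
Lemma Rintegral_cantor (R : realType) (N : nat) (D : {fset nat})
    (mu : probability (measurableTypeR R) R) (f : measurableTypeR R -> R) :
  is_cantor_measure N D mu -> D != fset0 -> measurable_fun setT f ->
  (forall x, `|f x| <= 1) ->
  \int[mu]_x f x =
    (#|` D|)%:R^-1 * \sum_(d <- D) \int[mu]_x f (phi N d x).
Proof.
move=> muD D0 mf f1.
have shift (g : measurableTypeR R -> R) : measurable_fun setT g ->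
    (forall x, `|g x| <= 1) ->
    (\int[mu]_x (1 + g x)%:E = (1 + \int[mu]_x g x)%:E)%E.
  move=> mg g1; under eq_integral do rewrite EFinD.
  rewrite integralD_EFin//; last 2 first.
  - by apply: (@bounded_integrable R mu (cst 1)) => // x; rewrite normr1.
  - exact: bounded_integrable.
  rewrite integral_cst// -[X in (_ * X)%E]/(mu setT).
  rewrite (@probability_setT _ _ _ mu) mule1 EFinD fineK//.
  by apply: integrable_fin_num => //; exact: (@bounded_integrable R mu g).
have D_gt0 : (#|` D|)%:R != 0 :> R by rewrite pnatr_eq0 cardfs_eq0.
have := @ge0_integral_cantor R N D mu (fun x => (1 + f x)%:E) muD.
rewrite shift// => /(_ _ _)/wrap[].
- by apply/measurable_EFinP; exact: measurable_funD.
- move=> x; rewrite lee_fin -lerBlDl sub0r.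
  by have := f1 x; rewrite ler_norml => /andP[].
under eq_bigr => d _.
  rewrite (shift (f \o phi N d)); last 2 first.
  - by apply: measurableT_comp => //; exact: measurable_phi.
  - by move=> x; exact: f1.
  over.
rewrite sumEFin -EFinM => -[]; rewrite big_split/= mulrDr.
by rewrite big_const_seq count_predT iter_addr_0 mulVf// => /addrI.
Qed.

(** * The exponential on the unit circle *)

Lemma sin_eq0_lt_pi (R : realType) (x : R) : 0 <= x < pi -> sin x = 0 -> x = 0.
Proof.
move=> /andP[x0 xpi] sx; apply/eqP; rewrite eq_le x0 andbT leNgt.
apply/negP => x_gt0; have := @sin_gt0_pi R x.
by rewrite x_gt0 xpi sx ltxx => /(_ isT).
Qed.

Lemma expi0 (R : realType) : expi (0 : R) = 1.
Proof. by rewrite /expi cos0 sin0. Qed.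

Lemma expiD (R : realType) (x y : R) : expi (x + y) = expi x * expi y.
Proof.
by rewrite /expi cosD sinD; simpc; congr (Complex _ _); rewrite addrC.
Qed.

Lemma expiN (R : realType) (x : R) : expi (- x) = conjc (expi x).
Proof. by rewrite /expi cosN sinN. Qed.

Lemma expiMn (R : realType) (x : R) (n : nat) : expi (n%:R * x) = expi x ^+ n.
Proof.
elim: n => [|n IHn]; first by rewrite mul0r expi0.
by rewrite -addn1 natrD mulrDl mul1r expiD IHn addn1 exprSr.
Qed.

Lemma expi_2pi_int (R : realType) (m : int) : expi (2 * pi * m%:~R : R) = 1.
Proof.
have e2pi : expi (2 * pi : R) = 1.
  by rewrite /expi mulr_natl cos2pi sin2pi.
case: m => n; first by rewrite mulrC expiMn e2pi expr1n.
by rewrite NegzE mulrC mulrNz mulNr expiN expiMn e2pi expr1n rmorph1.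
Qed.

(** For the fractional part [r] of [x], cos(2 pi r) = 1 gives sin(pi r) = 0 with pi r in [0, pi),
    hence r = 0. *)
Lemma expi_eq1 (R : realType) (x : R) :
  expi (2 * pi * x) = 1 <-> exists m : int, x = m%:~R.
Proof.
split=> [|[m ->]]; last exact: expi_2pi_int.
have pi0 := pi_gt0 R.
rewrite -(subrKC (Num.floor x)%:~R x) mulrDr expiD expi_2pi_int mul1r.
set r := x - _ => er.
have r01 : 0 <= r < 1 by rewrite /r subr_ge0 ltrBlDl -intrD1 floor_le floorD1_gt.
suff r0 : r = 0 by exists (Num.floor x); rewrite r0 addr0.
have : sin (pi * r) = 0.
  move: er; rewrite -mulrA mulr_natl => -[]; rewrite cos_mulr2n cos2sin2 => c1 _.
  by apply/eqP; rewrite -sqrf_eq0; apply/eqP; lra.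
move=> /sin_eq0_lt_pi; case/andP: r01 => r0 r1; rewrite mulr_ge0 ?(ltW pi0)//.
rewrite gtr_pMr// r1 => /(_ isT)/eqP; rewrite mulf_eq0 gt_eqF//= => /eqP//.
Qed.

Lemma complex_sum (R : rcfType) (I : Type) (r : seq I) (F : I -> R[i]) :
  \sum_(i <- r) F i =
  Complex (\sum_(i <- r) complex.Re (F i)) (\sum_(i <- r) complex.Im (F i)).
Proof.
elim/big_rec3: _ => [//|i y1 y2 y3 _ ->].
by case: (F i) => a b; simpc.
Qed.

(** * The Fourier transform of the measure and its zeros *)

(** With the positive sign in the exponent, the inner product of e_l and e_l' is the value at l -
    l'. *)
Definition fourier (R : realType) (mu : probability (measurableTypeR R) R)
    (xi : R) : R[i] :=
  Cintegral mu (efun xi).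

(** This is P_D at e^(2 pi i x), without the normalisation by |D|. *)
Definition mask_sum (R : realType) (D : {fset nat}) (x : R) : R[i] :=
  \sum_(d <- D) expi (2 * pi * x) ^+ d.

Section FourierTransform.
Context (R : realType) (mu : probability (measurableTypeR R) R).

Lemma Cintegral_efun (l l' : R) :
  Cintegral mu (fun x => efun l x * conjc (efun l' x)) = fourier mu (l - l').
Proof.
congr (Cintegral mu _); apply/funext => x.
by rewrite /efun -expiN -expiD; congr expi; ring.
Qed.

Lemma fourierE (xi : R) :
  fourier mu xi = Complex (\int[mu]_x cos (2 * pi * xi * x))
                          (\int[mu]_x sin (2 * pi * xi * x)).
Proof. by []. Qed.

Lemma measurable_cosM (a : R) :
  measurable_fun (setT : set (measurableTypeR R)) (fun x => cos (a * x)).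
Proof.
apply: (@continuous_measurable_fun R (fun x => cos (a * x))) => x.
apply: (@continuous_comp _ _ _ ( *%R a) (@cos R)); last exact: continuous_cos.
exact: mulrl_continuous.
Qed.

Lemma measurable_sinM (a : R) :
  measurable_fun (setT : set (measurableTypeR R)) (fun x => sin (a * x)).
Proof.
apply: (@continuous_measurable_fun R (fun x => sin (a * x))) => x.
apply: (@continuous_comp _ _ _ ( *%R a) (@sin R)); last exact: continuous_sin.
exact: mulrl_continuous.
Qed.

Lemma integrable_cos (a : R) :
  mu.-integrable setT (EFin \o (fun x => cos (a * x))).
Proof.
apply: (@bounded_integrable R mu (fun x => cos (a * x))).
  exact: measurable_cosM.
by move=> x; exact: cos_max.
Qed.

Lemma integrable_cosM (a b : R) :
  mu.-integrable setT (EFin \o (fun x => cos (a * x) * b)).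
Proof.
apply: eq_integrable (integrableZr measurableT b (integrable_cos a)) => //.
Qed.

Lemma integrable_sin (a : R) :
  mu.-integrable setT (EFin \o (fun x => sin (a * x))).
Proof.
apply: (@bounded_integrable R mu (fun x => sin (a * x))).
  exact: measurable_sinM.
by move=> x; exact: sin_max.
Qed.

Lemma integrable_sinM (a b : R) :
  mu.-integrable setT (EFin \o (fun x => sin (a * x) * b)).
Proof.
apply: eq_integrable (integrableZr measurableT b (integrable_sin a)) => //.
Qed.

(** Composing e_xi with phi_d gives e_(xi/N) times the constant e^(2 pi i d xi/N). Real and
    imaginary parts are treated apart, through the addition formulas, since [Cintegral] is defined
    componentwise. *)
Lemma fourier_cantor (N : nat) (D : {fset nat}) (xi : R) :
  is_cantor_measure N D mu -> D != fset0 ->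
  fourier mu xi =
    real_complex R (#|` D|)%:R^-1 * mask_sum D (xi / N%:R) *
      fourier mu (xi / N%:R).
Proof.
move=> muD D0.
have arg d (x : R) : 2 * pi * xi * phi N d x =
    2 * pi * (xi / N%:R) * x + d%:R * (2 * pi * (xi / N%:R)).
  by rewrite /phi; ring.
have icos d : \int[mu]_x cos (2 * pi * xi * phi N d x) =
    complex.Re (expi (2 * pi * (xi / N%:R)) ^+ d * fourier mu (xi / N%:R)).
  under eq_Rintegral => x _ do rewrite arg cosD.
  rewrite RintegralB ?RintegralZr//;
    do ?[exact: integrable_cos | exact: integrable_sin
        | exact: integrable_cosM | exact: integrable_sinM].
  rewrite -expiMn /expi fourierE; simpc => /=.
  by rewrite mulrC [X in _ - X]mulrC.
have isin d : \int[mu]_x sin (2 * pi * xi * phi N d x) =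
    complex.Im (expi (2 * pi * (xi / N%:R)) ^+ d * fourier mu (xi / N%:R)).
  under eq_Rintegral => x _ do rewrite arg sinD.
  rewrite RintegralD ?RintegralZr//;
    do ?[exact: integrable_cos | exact: integrable_sin
        | exact: integrable_cosM | exact: integrable_sinM].
  rewrite -expiMn /expi fourierE; simpc => /=.
  by rewrite mulrC [X in _ + X]mulrC.
rewrite fourierE.
rewrite (@Rintegral_cantor R N D mu (fun x => cos (2 * pi * xi * x)) muD D0);
  [|exact: measurable_cosM|by move=> x; exact: cos_max].
rewrite (@Rintegral_cantor R N D mu (fun x => sin (2 * pi * xi * x)) muD D0);
  [|exact: measurable_sinM|by move=> x; exact: sin_max].
under eq_bigr do rewrite icos.
under [in X in Complex _ X]eq_bigr do rewrite isin.
rewrite -[RHS]mulrA [in RHS]/mask_sum mulr_suml.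
by rewrite complex_sum; simpc.
Qed.

(** Dominated convergence with bound 1: the argument of the cosine tends to 0 pointwise. The real
    part suffices to keep the transform from vanishing at every [xi / N^k]. *)
Lemma cvg_fourier_Re (N : nat) (xi : R) : (1 < N)%N ->
  complex.Re (fourier mu (xi / N%:R ^+ k)) @[k --> \oo] --> (1 : R).
Proof.
move=> N1.
pose f k (x : measurableTypeR R) := (cos (2 * pi * (xi / N%:R ^+ k) * x))%:E.
have : (\int[mu]_x f k x)%E @[k --> \oo] --> (\int[mu]_x (cst 1%E x))%E.
  apply: (@dominated_cvg _ _ _ mu setT measurableT f (cst 1%E) (cst 1%E)) => //.
  - move=> k; apply/measurable_EFinP; exact: measurable_cosM.
  - move=> x _; apply: cvg_EFin; first by apply: nearW.
    have u0 : (fun k => 2 * pi * (xi / N%:R ^+ k) * x) @ \oo --> (0 : R).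
      have -> : (fun k => 2 * pi * (xi / N%:R ^+ k) * x) =
                (fun k => (2 * pi * xi * x) * (N%:R^-1) ^+ k) :> (nat -> R).
        by apply/funext => k; rewrite exprVn; ring.
      rewrite -(mulr0 (2 * pi * xi * x)); apply: cvgM; first exact: cvg_cst.
      apply: cvg_expr; rewrite ger0_norm ?invr_ge0// invf_lt1 ?ltr1n//.
      by rewrite ltr0n (ltn_trans _ N1).
    rewrite -[X in _ --> X](cos0 R); apply: (cvg_comp _ _ u0).
    exact: continuous_cos.
  - apply: (@bounded_integrable R mu (cst 1)) => // x; by rewrite normr1.
  - by move=> k x _; rewrite /f/= lee_fin cos_max.
rewrite integral_cst// -[X in (_ * X)%E]/(mu setT).
rewrite (@probability_setT _ _ _ mu) mule1.
by move=> /fine_cvg.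
Qed.

(** A vanishing mask factor kills the transform at [xi / N^k] and hence, going back through the
    factorisation, at [xi]. If no factor vanishes, a zero at [xi] descends to every [xi / N^k],
    against the limit 1. *)
Lemma fourier_eq0 (N : nat) (D : {fset nat}) (xi : R) :
  is_cantor_measure N D mu -> D != fset0 -> (1 < N)%N ->
  fourier mu xi = 0 <->
  exists k, mask_sum D (xi / N%:R ^+ k.+1) = 0.
Proof.
move=> muD D0 N1.
have step (x : R) k : fourier mu (x / N%:R ^+ k) =
    real_complex R (#|` D|)%:R^-1 * mask_sum D (x / N%:R ^+ k.+1) *
      fourier mu (x / N%:R ^+ k.+1).
  by rewrite (fourier_cantor _ muD D0) exprSr invfM !mulrA.
split=> [xi0|[k k0]]; last first.
  suff : fourier mu (xi / N%:R ^+ 0) = 0 by rewrite expr0 divr1.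
  have : fourier mu (xi / N%:R ^+ k) = 0 by rewrite step k0 mulr0 mul0r.
  by elim: k {k0} => [//|k IHk] k0; apply: IHk; rewrite step k0 mulr0.
apply: contrapT => noz.
have all0 k : fourier mu (xi / N%:R ^+ k) = 0.
  elim: k => [|k]; first by rewrite expr0 divr1.
  rewrite step => /eqP; rewrite !mulf_eq0 => /orP[/orP[]|/eqP//] /eqP.
    move=> [] /eqP; rewrite invr_eq0 pnatr_eq0 cardfs_eq0.
    by rewrite (negbTE D0).
  by move=> k0; exfalso; apply: noz; exists k.
have /cvg_lim := @cvg_fourier_Re N xi N1.
under eq_fun do rewrite all0.
rewrite lim_cst// => /(_ (@norm_hausdorff _ _)) /esym /eqP.
by rewrite oner_eq0.
Qed.

End FourierTransform.

(** * Cyclotomic polynomials of prime power index *)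

Lemma perm_divisors_primepow (p n : nat) : prime p ->
  perm_eq (divisors (p ^ n)) [seq (p ^ i)%N | i <- iota 0 n.+1].
Proof.
move=> p_pr; apply: uniq_perm; first exact: divisors_uniq.
  by rewrite map_inj_uniq ?iota_uniq//; apply: expnI; exact: prime_gt1.
move=> x; rewrite -dvdn_divisors ?expn_gt0 ?prime_gt0//.
apply/(dvdn_pfactor _ _ p_pr)/mapP => [[m mn ->]|[m]].
  by exists m; rewrite // mem_iota.
by rewrite mem_iota => /andP[_ mn] ->; exists m.
Qed.

(** The Phi_(p^i) with i <= m multiply to X^(p^m) - 1; the quotient of two consecutive such products
    is a geometric sum. *)
Lemma Cyclotomic_primepow (p n : nat) : prime p ->
  'Phi_(p ^ n.+1) = \sum_(i < p) 'X^(p ^ n) ^+ i :> {poly int}.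
Proof.
move=> p_pr; have pn_gt0 m : (0 < p ^ m)%N by rewrite expn_gt0 prime_gt0.
have prodPhi m : \prod_(i <- iota 0 m.+1) 'Phi_(p ^ i) = 'X^(p ^ m) - 1.
  rewrite -prod_Cyclotomic// (perm_big _ (perm_divisors_primepow m p_pr)).
  by rewrite big_map.
have := prodPhi n.+1; rewrite -[X in iota _ X]addn1 iotaD.
rewrite big_cat/= big_seq1 prodPhi add0n.
rewrite [in RHS]expnSr exprM [RHS]subrX1 => /mulfI; apply.
by rewrite monic_neq0// (monicXnsubC 1).
Qed.

Lemma Cyclotomic_primepow_coef_ge0 (p n k : nat) : prime p ->
  0 <= ('Phi_(p ^ n.+1))`_k :> int.
Proof.
move=> p_pr; rewrite Cyclotomic_primepow// coef_sum sumr_ge0// => i _.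
by rewrite -exprM coefXn.
Qed.

Lemma coef_prod_ge0 (R : numDomainType) (I : eqType) (r : seq I)
    (F : I -> {poly R}) (k : nat) :
  (forall i, i \in r -> forall j, 0 <= (F i)`_j) -> 0 <= (\prod_(i <- r) F i)`_k.
Proof.
move=> F_ge0; rewrite big_seq; elim/big_rec: _ k => [k|i Q /F_ge0 Fi IHQ k].
  by rewrite coefC; case: eqP.
by rewrite coefM sumr_ge0// => j _; rewrite mulr_ge0.
Qed.

Lemma Cyclotomic_primepow_horner0 (p n : nat) : prime p ->
  ('Phi_(p ^ n.+1)).[0] = 1 :> int.
Proof.
move=> p_pr; rewrite Cyclotomic_primepow// horner_sum.
case: p p_pr => // p p_pr; rewrite big_ord_recl expr0 hornerC.
rewrite big1 ?addr0// => i _.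
by rewrite !hornerE/= expr0n expn_eq0/= expr0n.
Qed.

Lemma Cyclotomic_primepow_horner1 (p n : nat) : prime p ->
  ('Phi_(p ^ n.+1)).[1] = p%:Z :> int.
Proof.
move=> p_pr; rewrite Cyclotomic_primepow// horner_sum.
under eq_bigr do rewrite !hornerE/= !expr1n.
by rewrite sumr_const card_ord natz.
Qed.

Lemma Cyclotomic_primepow_coef (p n : nat) : prime p ->
  ('Phi_(p ^ n.+1))`_(p ^ n) = 1 :> int.
Proof.
move=> p_pr; rewrite Cyclotomic_primepow// coef_sum.
have pn_gt0 : (0 < p ^ n)%N by rewrite expn_gt0 prime_gt0.
rewrite (bigD1 (Ordinal (prime_gt1 p_pr)))//= expr1 coefXn eqxx big1 ?addr0//.
move=> i ine1; rewrite -exprM coefXn -{1}[(p ^ n)%N]muln1 eqn_pmul2l//.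
by rewrite eq_sym; move: ine1; rewrite -val_eqE/= => /negbTE ->.
Qed.

(** Evaluating (X^(p^n) - 1) Phi_(p^(n+1)) = X^(p^(n+1)) - 1 at [z] settles all but the case z^(p^n)
    = 1, where Phi takes the nonzero value p. *)
Lemma root_Cyclotomic_primepow (F : numFieldType) (p n : nat) (z : F) :
  prime p ->
  ((map_poly intr 'Phi_(p ^ n.+1)).[z] == 0) =
  (z ^+ (p ^ n.+1) == 1) && (z ^+ (p ^ n) != 1).
Proof.
move=> p_pr; rewrite Cyclotomic_primepow// rmorph_sum horner_sum.
under eq_bigr do rewrite /= !rmorphXn /= map_polyX !hornerE.
rewrite expnSr exprM -[X in _ = X && _]subr_eq0 subrX1 mulf_eq0 subr_eq0.
have [->|_] := eqVneq (z ^+ (p ^ n)) 1; last by rewrite andbT.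
under eq_bigr do rewrite expr1n.
by rewrite sumr_const card_ord andbF pnatr_eq0 eqn0Ngt prime_gt0.
Qed.

(** * The mask polynomial and its cyclotomic factors *)

Lemma coef_mask_poly (D : {fset nat}) (k : nat) :
  (mask_poly D)`_k = (k \in D)%:R.
Proof.
rewrite /mask_poly coef_sum.
under eq_bigr do rewrite coefXn.
have [kD|kD] := boolP (k \in D); last first.
  by rewrite big_seq big1// => d dD; case: eqP kD => // ->; rewrite dD.
rewrite (big_fsetD1 k)//= eqxx big1_fset ?addr0// => d.
by rewrite !inE eq_sym => /andP[/negbTE ->].
Qed.

Lemma mask_poly_neq0 (D : {fset nat}) : D != fset0 -> mask_poly D != 0.
Proof.
move=> /fset0Pn[d dD]; apply/eqP => /(congr1 (fun P : {poly int} => P`_d)).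
by rewrite coef_mask_poly dD coef0.
Qed.

Lemma mask_poly_horner1 (D : {fset nat}) : (mask_poly D).[1] = (#|` D|)%:Z.
Proof.
rewrite /mask_poly horner_sum; under eq_bigr do rewrite hornerXn expr1n.
by rewrite big_const_seq count_predT iter_addr_0 natz.
Qed.

Lemma mask_sumE (R : realType) (D : {fset nat}) (x : R) :
  mask_sum D x = (map_poly intr (mask_poly D)).[expi (2 * pi * x)].
Proof.
rewrite /mask_poly rmorph_sum horner_sum.
by apply: eq_bigr => d _; rewrite rmorphXn/= map_polyX !hornerE.
Qed.

(** The degree (p - 1) p^(t-1) of a divisor is at least t, so the degree of P_D bounds t. Finiteness
    lets the product over T be handled as an ordinary finite product. *)
Lemma finite_cyclotomic_exponents (p : nat) (D : {fset nat}) :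
  prime p -> D != fset0 -> finite_set (cyclotomic_exponents p D).
Proof.
move=> p_pr D0; apply: (sub_finite_set _ (finite_II (size (mask_poly D)))).
move=> -[|t] [//= _ /(dvdp_leq (mask_poly_neq0 D0))].
rewrite size_Cyclotomic totient_pfactor// => /(leq_trans _); apply.
rewrite ltnS; apply: (leq_trans (ltn_expl t (prime_gt1 p_pr))).
by rewrite leq_pmull// -ltnS prednK ?prime_gt1 ?prime_gt0.
Qed.

Section ProductOfCyclotomics.
Variables (p alpha : nat) (D : {fset nat}).
Hypotheses (p_prime : prime p) (D_neq0 : D != fset0).
Hypothesis D_inj_mod : forall a b : nat, a \in D -> b \in D ->
  a = b %[mod p ^ alpha] -> a = b.
Local Notation T := (cyclotomic_exponents p D).
Hypothesis D_prod : mask_poly D = \big[*%R/1]_(t \in T) 'Phi_(p ^ t).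

(* The coefficients of the product at 0 and p^(t-1) are positive, so D contains
   both exponents; they are congruent modulo p^alpha as soon as t > alpha. *)
Lemma cyclotomic_exponents_le (t : nat) : T t -> (t <= alpha)%N.
Proof.
move=> Tt; have finT := finite_cyclotomic_exponents p_prime D_neq0.
have t_s : t \in fset_set T by rewrite in_fset_set ?inE.
have Phi_ge0 u : u \in fset_set T -> forall k, 0 <= ('Phi_(p ^ u))`_k :> int.
  rewrite in_fset_set// inE => -[]; case: u => // u _ _ k.
  exact: Cyclotomic_primepow_coef_ge0.
have Phi0 u : u \in fset_set T -> ('Phi_(p ^ u)).[0] = 1 :> int.
  rewrite in_fset_set// inE => -[]; case: u => // u _ _.
  exact: Cyclotomic_primepow_horner0.
have := D_prod; rewrite fsbig_finite//= => PD.
have D_0 : (0 \in D)%N.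
  have := coef_mask_poly D 0; rewrite -horner_coef0 PD horner_prod.
  by rewrite big_seq big1//; case: (0%N \in D).
case: t Tt t_s => // t _ t_s.
have D_pt : (p ^ t)%N \in D.
  have := coef_mask_poly D (p ^ t); rewrite PD (big_fsetD1 _ t_s)/=.
  set Q := \prod_(_ <- _) _.
  have Q_ge0 k : 0 <= Q`_k.
    by apply: coef_prod_ge0 => u /fsetD1P[_]; exact: Phi_ge0.
  have Q0 : Q`_0 = 1.
    rewrite -horner_coef0 horner_prod big_seq big1// => u /fsetD1P[_].
    exact: Phi0.
  (* The last term of the convolution is 1 and the others are nonnegative, so the coefficient is not
     0. *)
  rewrite coefM big_ord_recr/= subnn Q0 mulr1 Cyclotomic_primepow_coef//.
  case: (_ \in D) => // /eqP; rewrite gt_eqF// ltr_wpDl// sumr_ge0// => i _.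
  by rewrite mulr_ge0// Phi_ge0.
rewrite ltnNge; apply/negP => alpha_t.
have := D_inj_mod D_0 D_pt; rewrite mod0n => /(_ _)/esym/eqP.
rewrite expn_eq0 eqn0Ngt prime_gt0//= => /(_ _)/notF; apply.
by apply/esym/eqP; rewrite -/(dvdn _ _) dvdn_exp2l.
Qed.

(** Reindexing by v = alpha - t turns 0 < t <= alpha into 0 <= v < alpha; this [v] will be the
    residue modulo alpha of a p-adic valuation. *)
Lemma mask_poly_prod :
  mask_poly D =
  \prod_(0 <= v < alpha | (alpha - v)%N \in T) 'Phi_(p ^ (alpha - v)).
Proof.
have finT := finite_cyclotomic_exponents p_prime D_neq0.
rewrite D_prod fsbig_finite//= -[RHS]big_filter.
rewrite -(big_map (fun v => (alpha - v)%N) predT (fun t => 'Phi_(p ^ t))).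
apply: perm_big; apply: uniq_perm; first exact: fset_uniq.
  rewrite map_inj_in_uniq ?filter_uniq ?iota_uniq// => u v.
  rewrite !mem_filter !mem_index_iota => /and3P[_ _ ua] /and3P[_ _ va] uv.
  by rewrite -(subKn (ltnW ua)) uv subKn// ltnW.
move=> t; rewrite in_fset_set//; apply/idP/mapP => [tT|[v]]; last first.
  by rewrite mem_filter => /andP[] ? _ ->.
have t_le := cyclotomic_exponents_le (set_mem tT).
have t_gt0 : (0 < t)%N by case: (set_mem tT).
exists (alpha - t)%N; rewrite ?subKn//.
rewrite mem_filter subKn// tT mem_index_iota/=.
by rewrite ltn_subrL t_gt0 (leq_trans t_gt0).
Qed.
End ProductOfCyclotomics.

(** * p-adic valuations of integers *)

(** States that [m] has p-adic valuation [e]; no [e] fits m = 0. *)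
Definition exact_dvdz (p e : nat) (m : int) : Prop :=
  ((p ^ e)%N%:Z %| m)%Z /\ ~ ((p ^ e.+1)%N%:Z %| m)%Z.

Lemma dvdz_pow (p a b : nat) (m : int) : (a <= b)%N ->
  ((p ^ b)%N%:Z %| m)%Z -> ((p ^ a)%N%:Z %| m)%Z.
Proof. by move=> ab; apply: dvdz_trans; rewrite dvdzE/= dvdn_exp2l. Qed.

Lemma exact_dvdzN (p e : nat) (m : int) :
  exact_dvdz p e m -> exact_dvdz p e (- m).
Proof. by case; rewrite /exact_dvdz !dvdzE !abszN. Qed.

Lemma exact_dvdz_add (p e : nat) (a b : int) :
  ((p ^ e.+1)%N%:Z %| b)%Z -> exact_dvdz p e a -> exact_dvdz p e (a + b).
Proof.
move=> pb [pa npa]; split; first by rewrite rpredD// (dvdz_pow (leqnSn e)).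
by rewrite rpredDr.
Qed.

Lemma intr_div_dvdz (R : realType) (d : nat) (m : int) : (0 < d)%N ->
  (exists q : int, m%:~R / d%:R = q%:~R :> R) <-> (d%:Z %| m)%Z.
Proof.
move=> d0; have d0R : d%:R != 0 :> R by rewrite pnatr_eq0 -lt0n.
split=> [[q mq]|/dvdzP[q ->]]; last first.
  by exists q; rewrite intrM -[d%:Z%:~R]/(d%:R) mulfK.
apply/dvdzP; exists q; apply: (@intr_inj R).
by rewrite intrM -mq -[d%:Z%:~R]/(d%:R) divfK.
Qed.

(** * Counting the residue classes met by a fully branching set *)

Section CoveringSequences.
Variables (p : nat) (V : pred nat) (A : set int).
Hypothesis p_gt1 : (1 < p)%N.
Hypothesis A_sep : forall a b : int, A a -> A b -> a <> b ->
  exists2 e, V e & exact_dvdz p e (a - b).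
Hypothesis A_full : forall (a : int) (e : nat) (c : int), A a -> V e ->
  exists2 b, A b & ((p ^ e.+1)%N%:Z %| b - (a + c * (p ^ e)%N%:Z))%Z.

(** Representatives, modulo p^(u+v), of the part of [A] congruent to [a0] modulo p^u, by induction
    on [v]. At a level in [V] each class splits into p classes by [A_full]; at any other level
    [A_sep] forbids a split. *)
Lemma exists_representatives (u : nat) (a0 : int) (v : nat) : A a0 ->
  exists s : seq int,
  [/\ uniq s,
      size s = (p ^ count (fun i => V (u + i)%N) (iota 0 v))%N,
      forall x, x \in s -> A x /\ ((p ^ u)%N%:Z %| x - a0)%Z,
      forall x y, x \in s -> y \in s ->
        ((p ^ (u + v))%N%:Z %| x - y)%Z -> x = y &
      forall x, A x -> ((p ^ u)%N%:Z %| x - a0)%Z ->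
        exists2 y, y \in s & ((p ^ (u + v))%N%:Z %| x - y)%Z].
Proof.
move=> Aa0; elim: v => [|v [s [s_uniq s_size sA s_inj s_cov]]].
  exists [:: a0]; split => //.
  - by move=> x; rewrite inE => /eqP ->; rewrite subrr dvdz0.
  - by move=> x y; rewrite !inE => /eqP -> /eqP ->.
  - by move=> x Ax; rewrite addn0 => xa0; exists a0; rewrite ?inE.
rewrite -[in iota _ _](addn1 v) iotaD count_cat expnD -s_size/= add0n addn0 addnS.
have [Vv|nVv] := boolP (V (u + v)%N); last first.
  rewrite muln1; exists s; split => // [x y xs ys xy|x Ax xa0].
    by apply: s_inj => //; exact: dvdz_pow (leqnSn _) xy.
  have [y ys xy] := s_cov _ Ax xa0; exists y => //.
  have [->|/eqP x_ne_y] := eqVneq x y; first by rewrite subrr dvdz0.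
  (* The valuation of x - y is at least u + v, and differs from it because u + v is not in [V]. *)
  have [e Ve [e_xy nxy]] := A_sep Ax (sA _ ys).1 x_ne_y.
  apply: (dvdz_pow _ e_xy); rewrite ltn_neqAle; apply/andP; split.
    by apply: contraNneq nVv => ->.
  by rewrite leqNgt; apply/negP => e_lt; apply: nxy; exact: dvdz_pow e_lt xy.
(* [f (x, c)] is an element of [A] in the c-th subclass of the class of [x]; 0 is a default value
   outside [A]. *)
have /choice[f f_P] (xc : int * nat) : exists b : int, A xc.1 ->
    A b /\ ((p ^ (u + v).+1)%N%:Z %| b - (xc.1 + xc.2%:Z * (p ^ (u + v))%N%:Z))%Z.
  have [Ax|nAx] := pselect (A xc.1); last by exists 0.
  by have [b Ab bx] := A_full xc.2%:Z Ax Vv; exists b.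
have f_A x c : x \in s -> A (f (x, c)) by move=> /sA[Ax _]; case: (f_P (x, c) Ax).
have f_x x c : x \in s ->
    ((p ^ (u + v).+1)%N%:Z %| f (x, c) - (x + c%:Z * (p ^ (u + v))%N%:Z))%Z.
  by move=> /sA[Ax _]; case: (f_P (x, c) Ax).
have f_near x c : x \in s -> ((p ^ (u + v))%N%:Z %| f (x, c) - x)%Z.
  move=> /(f_x _ c)/(dvdz_pow (leqnSn _)).
  by rewrite opprD addrA rpredBr// dvdz_mull.
have p_gt0 : (0 < p)%N by exact: ltnW.
have f_inj x c y c' : x \in s -> y \in s -> (c < p)%N -> (c' < p)%N ->
    ((p ^ (u + v).+1)%N%:Z %| f (x, c) - f (y, c'))%Z -> x = y /\ c = c'.
  move=> xs ys cp c'p ff.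
  have xy : x = y.
    apply: s_inj => //.
    have -> : x - y = (f (x, c) - f (y, c')) - (f (x, c) - x) + (f (y, c') - y).
      by ring.
    apply: rpredD; last exact: f_near.
    by apply: rpredB; [exact: dvdz_pow (leqnSn _) ff|exact: f_near].
  subst y; split=> //.
  have : ((p ^ (u + v).+1)%N%:Z %| (c%:Z - c'%:Z) * (p ^ (u + v))%N%:Z)%Z.
    have -> : (c%:Z - c'%:Z) * (p ^ (u + v))%N%:Z =
        (f (x, c) - f (x, c'))
        - (f (x, c) - (x + c%:Z * (p ^ (u + v))%N%:Z))
        + (f (x, c') - (x + c'%:Z * (p ^ (u + v))%N%:Z)) by ring.
    by apply: rpredD; [apply: rpredB|] => //; exact: f_x.
  rewrite expnS PoszM dvdz_mul2r; last by rewrite -lt0n expn_gt0 p_gt0.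
  by rewrite -eqz_mod_dvd !modz_nat !modn_small// => /eqP[].
exists [seq f (x, c) | x <- s, c <- iota 0 p]; split.
- apply: allpairs_uniq; rewrite ?iota_uniq//.
  move=> [x c] [y c'] /allpairsP[[x1 c1]/= [x1s c1p [-> ->]]].
  move=> /allpairsP[[y1 c2]/= [y1s c2p [-> ->]]] /= ff.
  rewrite !mem_iota in c1p c2p.
  by have [] := f_inj x1 c1 y1 c2; rewrite ?ff ?subrr ?dvdz0// => -> ->.
- by rewrite size_allpairs size_iota expn1.
- move=> _ /allpairsP[[x c]/= [xs _ ->]]; split; first exact: f_A.
  have -> : f (x, c) - a0 = (f (x, c) - x) + (x - a0) by ring.
  apply: rpredD; last exact: (sA _ xs).2.
  exact: dvdz_pow (leq_addr v u) (f_near _ _ xs).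
- move=> _ _ /allpairsP[[x c]/= [xs cp ->]] /allpairsP[[y c']/= [ys c'p ->]].
  by rewrite !mem_iota in cp c'p => /f_inj[] // -> ->.
- move=> x Ax xa0; have [y ys xy] := s_cov _ Ax xa0.
  have [q xyq] := dvdzP xy.
  (* The subclass of [x] is found by reducing the quotient of x - y by p^(u+v) modulo p. *)
  have [c cp qc] : exists2 c : nat, (c < p)%N & (p%:Z %| q - c%:Z)%Z.
    exists `|(q %% p%:Z)%Z|%N.
      by rewrite -ltz_nat gez0_abs ?ltz_pmod ?modz_ge0// -lt0n.
    by rewrite gez0_abs ?modz_ge0 -?lt0n// -eqz_mod_dvd modz_mod.
  exists (f (y, c)); first by apply/allpairsP; exists (y, c); rewrite mem_iota.
  have -> : x - f (y, c) = (q - c%:Z) * (p ^ (u + v))%N%:Z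
      - (f (y, c) - (y + c%:Z * (p ^ (u + v))%N%:Z)).
    by rewrite -[x](subrK y) xyq; ring.
  apply: rpredB; last exact: f_x.
  by rewrite expnS PoszM; exact: dvdz_mul.
Qed.
End CoveringSequences.

(** * Base-N digits as congruences *)

Lemma base_tail_diff (N n : nat) (a b : int) :
  (forall j, (j < n)%N -> digit N j a = digit N j b) ->
  a - b = (N ^ n)%N%:Z * (base_tail N n a - base_tail N n b).
Proof.
elim: n => [|n IHn] ab; first by rewrite expn0 mul1r.
rewrite IHn; last by move=> j jn; apply: ab; exact: ltnW.
rewrite (base_tailE N n a) (base_tailE N n b) ab// expnSr PoszM.
by ring.
Qed.

(** For the converse, once n digits agree, a - b is N^n times the difference of the tails, so
    divisibility by N^(n+1) makes the tails congruent modulo N. *)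
Lemma digits_eq_dvdz (N n : nat) (a b : int) : (0 < N)%N ->
  (forall j, (j < n)%N -> digit N j a = digit N j b) <->
  ((N ^ n)%N%:Z %| a - b)%Z.
Proof.
move=> N0; split=> [/base_tail_diff ->|]; first exact: dvdz_mulr.
elim: n => // n IHn ab.
have digits_n : forall j, (j < n)%N -> digit N j a = digit N j b.
  by apply: IHn; apply: dvdz_trans ab; rewrite dvdzE/= dvdn_exp2l.
move=> j; rewrite ltnS leq_eqVlt => /predU1P[->|]; last exact: digits_n.
apply/eqP; rewrite /digit eqz_mod_dvd.
move: ab; rewrite (base_tail_diff digits_n) expnSr PoszM dvdz_mul2l//.
by rewrite -lt0n expn_gt0 N0.
Qed.

Lemma frequencies_with_digitsE (R : realType) (N : nat) (Lambda : set R)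
    (n : nat) (d : 'I_n -> int) (a b : int) : (0 < N)%N ->
  frequencies_with_digits N Lambda d a ->
  frequencies_with_digits N Lambda d b <->
  Lambda b%:~R /\ ((N ^ n)%N%:Z %| b - a)%Z.
Proof.
move=> N0 [_ da]; split=> -[Lb db]; split=> //.
  apply/(digits_eq_dvdz _ _ _ N0) => j jn.
  by rewrite (db (Ordinal jn)) -(da (Ordinal jn)).
by move=> j; rewrite -da; apply: (digits_eq_dvdz _ _ _ N0).2 db _ _.
Qed.

(** A left inverse of a square matrix is a right inverse, so orthonormal columns suffice. *)
Lemma unitarymx_map_trmx (C : numClosedFieldType) (m n : nat) (M : 'M[C]_(m, n)) :
  m = n -> (map_mx Num.conj M^T) *m M = 1%:M -> M \is unitarymx.
Proof.
by move=> mn; subst n => MM; apply/unitarymxP; exact: mulmx1C.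
Qed.

(* The transform of mu vanishes exactly at the integers m such that the largest
   e with p^e dividing m satisfies this predicate. *)
Definition zero_exponent (p alpha : nat) (D : {fset nat}) : pred nat :=
  fun e => (alpha - e %% alpha)%N \in cyclotomic_exponents p D.

(** * Zeros of the transform in terms of p-adic valuations *)

Section Zeros.
Context (R : realType) (p alpha : nat) (D : {fset nat}).
Hypotheses (p_prime : prime p) (alpha_ge1 : (1 <= alpha)%N).
Hypothesis D_neq0 : D != fset0.
Hypothesis D_inj_mod : forall a b : nat, a \in D -> b \in D ->
  a = b %[mod p ^ alpha] -> a = b.
Local Notation T := (cyclotomic_exponents p D).
Hypothesis D_prod : mask_poly D = \big[*%R/1]_(t \in T) 'Phi_(p ^ t).

Local Notation V := (zero_exponent p alpha D).

Let V_lt v : (v < alpha)%N -> V v = ((alpha - v)%N \in T).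
Proof. by move=> va; rewrite /zero_exponent/= modn_small. Qed.

Lemma zero_exponent_addM k v : V (alpha * k + v)%N = V v.
Proof. by rewrite /zero_exponent/= mulnC modnMDl. Qed.

(** Both sides are P_D(1), since each factor Phi_(p^t) takes the value p at 1. *)
Lemma card_digit_set : #|` D| = (p ^ count V (iota 0 alpha))%N.
Proof.
apply/eqP; rewrite -eqz_nat -mask_poly_horner1.
rewrite (mask_poly_prod p_prime D_neq0 D_inj_mod D_prod) horner_prod.
rewrite -big_filter big_seq (eq_bigr (fun=> p%:Z)); last first.
  move=> v; rewrite mem_filter mem_index_iota => /and3P[_ _ va].
  by rewrite -(prednK (n := alpha - v)) ?subn_gt0// Cyclotomic_primepow_horner1.
rewrite -big_seq big_const_seq count_predT size_filter.
rewrite (@eq_in_count _ _ V); last first.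
  by move=> v; rewrite mem_index_iota => /andP[_ va]; rewrite V_lt.
rewrite /index_iota subn0; elim: (count _ _) => //= c.
by rewrite expnS PoszM => /eqP ->.
Qed.

(** Some factor must vanish, that is, e^(2 pi i x) has order exactly p^(alpha - v); the two
    integrality conditions express this order. *)
Lemma mask_sum_eq0 (x : R) :
  mask_sum D x = 0 <->
  exists v, [/\ (v < alpha)%N, V v,
    exists m : int, (p ^ (alpha - v))%:R * x = m%:~R &
    ~ exists m : int, (p ^ (alpha - v).-1)%:R * x = m%:~R].
Proof.
have rootE v : (v < alpha)%N ->
    (map_poly intr 'Phi_(p ^ (alpha - v))).[expi (2 * pi * x)] = 0 <->
    ((exists m : int, (p ^ (alpha - v))%:R * x = m%:~R) /\
    ~ exists m : int, (p ^ (alpha - v).-1)%:R * x = m%:~R).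
  rewrite -subn_gt0; case: (alpha - v)%N => // t _ /=.
  have expiX k : expi (2 * pi * x) ^+ k = 1 <-> exists m : int, k%:R * x = m%:~R.
    rewrite -expiMn -expi_eq1.
    by have -> : k%:R * (2 * pi * x) = 2 * pi * (k%:R * x) by ring.
  split=> [/eqP|[/expiX zpt zpt']].
    rewrite root_Cyclotomic_primepow// => /andP[/eqP/expiX ? /eqP nz].
    by split=> // /expiX.
  apply/eqP; rewrite root_Cyclotomic_primepow// zpt eqxx/=.
  by apply/eqP => /expiX.
rewrite mask_sumE (mask_poly_prod p_prime D_neq0 D_inj_mod D_prod).
rewrite rmorph_prod horner_prod; split=> [/eqP|[v [va Vv xm nxm]]].
  rewrite prodf_seq_eq0 => /hasP[v]; rewrite mem_index_iota => /andP[_ va].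
  move=> /andP[vT /eqP/(rootE _ va)[xm nxm]].
  by exists v; rewrite V_lt.
apply/eqP; rewrite prodf_seq_eq0; apply/hasP; exists v.
  by rewrite mem_index_iota.
by rewrite -V_lt// Vv/=; apply/eqP/rootE.
Qed.

Lemma mask_sum_div_eq0 (xi : R) (k : nat) :
  mask_sum D (xi / (p ^ alpha)%N%:R ^+ k.+1) = 0 <->
  exists m v, [/\ xi = m%:~R, (v < alpha)%N, V v &
                  exact_dvdz p (alpha * k + v)%N m].
Proof.
have p_gt0 := prime_gt0 p_prime.
have pX_neq0 n : (p ^ n)%N%:R != 0 :> R by rewrite pnatr_eq0 -lt0n expn_gt0 p_gt0.
(* Complementary exponents turn integrality of p^u x into divisibility of [xi] by p^e; lowering u by
   one raises e by one, which gives the exact valuation alpha k + v. *)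
have scale u e : (u + e)%N = (alpha * k.+1)%N ->
    (p ^ u)%:R * (xi / (p ^ alpha)%N%:R ^+ k.+1) = xi / (p ^ e)%N%:R :> R.
  move=> ue; rewrite -natrX -expnM -ue expnD natrM invfM mulrCA.
  by rewrite mulVKf.
have exp1 v : (v < alpha)%N -> (alpha - v + (alpha * k + v))%N = (alpha * k.+1)%N.
  by move=> va; rewrite mulnS addnCA subnK ?(ltnW va)// addnC.
have exp2 v : (v < alpha)%N ->
    ((alpha - v).-1 + (alpha * k + v).+1)%N = (alpha * k.+1)%N.
  move=> va; rewrite -(exp1 _ va).
  by rewrite -[in RHS](prednK (n := alpha - v)) ?subn_gt0// addSnnS.
rewrite mask_sum_eq0; split=> [[v [va Vv]]|[m [v [xim va Vv [pm npm]]]]].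
  rewrite (scale _ _ (exp1 _ va)) (scale _ _ (exp2 _ va)) => -[q xiq] nq.
  have xiE : xi = (q * (p ^ (alpha * k + v))%N%:Z)%:~R.
    by rewrite intrM -xiq -[(Posz _)%:~R]/((p ^ (alpha * k + v))%N%:R) divfK.
  exists (q * (p ^ (alpha * k + v))%N%:Z), v.
  split=> //; split; first exact: dvdz_mull.
  by move/(@intr_div_dvdz R _ _); rewrite -xiE expn_gt0 p_gt0 => /(_ isT).
exists v; rewrite (scale _ _ (exp1 _ va)) (scale _ _ (exp2 _ va)) xim.
split=> //; first by apply/intr_div_dvdz; rewrite ?expn_gt0 ?p_gt0.
by move=> /intr_div_dvdz pm'; apply: npm; apply: pm'; rewrite expn_gt0 p_gt0.
Qed.

Lemma fourier_cantor_eq0 (mu : probability (measurableTypeR R) R) (xi : R) :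
  is_cantor_measure (p ^ alpha) D mu ->
  fourier mu xi = 0 <->
  exists2 m, xi = m%:~R & exists2 e, V e & exact_dvdz p e m.
Proof.
move=> muD; have N_gt1 : (1 < p ^ alpha)%N.
  by rewrite -(exp1n alpha) ltn_exp2r// prime_gt1.
rewrite (fourier_eq0 _ muD D_neq0 N_gt1).
split=> [[k /mask_sum_div_eq0[m [v [-> va Vv pm]]]]|[m xim [e Ve pm]]].
  by exists m => //; exists (alpha * k + v)%N => //; rewrite zero_exponent_addM.
(* Euclidean division of the valuation by alpha gives the level k and the residue v. *)
exists (e %/ alpha)%N; apply/mask_sum_div_eq0.
have e_eq : (alpha * (e %/ alpha) + e %% alpha)%N = e by rewrite mulnC -divn_eq.
exists m, (e %% alpha)%N; rewrite e_eq ltn_pmod//.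
by split=> //; rewrite -(zero_exponent_addM (e %/ alpha)) e_eq.
Qed.
End Zeros.

(** * Hadamard matrices and maximal sets of frequencies *)

Lemma conj_expi (R : realType) (x : R) : Num.conj (expi x) = expi (- x).
Proof. by rewrite expiN. Qed.

(** The inner product of the columns of [l] and [l'] is the mask sum at (l' - l)/N divided by |D|;
    on the diagonal the mask sum is |D|. *)
Lemma hadamard_tripleP (R : realType) (N : nat) (D : {fset nat})
    (B : {fset int}) : D != fset0 -> #|` B| = #|` D| ->
  (forall l l', l \in B -> l' \in B -> l <> l' ->
    mask_sum D ((l - l')%:~R / N%:R : R) = 0) ->
  hadamard_triple R N [fset Posz a | a in D]%fset B.
Proof.
move=> D0 BD orthB.
have cardA : #|` [fset Posz a | a in D]%fset| = #|` D|.
  by rewrite card_imfset// => a b [].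
split; first by rewrite cardA BD.
apply: unitarymx_map_trmx; first by rewrite cardA BD.
apply/matrixP => k k'; rewrite !mxE.
set A := [fset Posz a | a in D]%fset in cardA *.
set c := real_complex R (Num.sqrt (#|` A|)%:R)^-1.
pose l := nth 0 B k; pose l' := nth 0 B k'.
pose F (a : int) := expi (2 * pi * ((a * (l' - l))%:~R / N%:R) : R).
have term j : (map_mx Num.conj (hadamard_matrix R N A B)^T) k j *
    hadamard_matrix R N A B j k' = c ^+ 2 * F (nth 0 A j).
  rewrite !mxE rmorphM/= conj_expi -/c -/l -/l'.
  have -> : Num.conj c = c.
    by rewrite /c; apply/eqP; rewrite eq_complex/= oppr0 !eqxx.
  rewrite mulrACA -expr2 -expiD; congr (_ * expi _).
  by rewrite mulrBr intrB; ring.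
under eq_bigr do rewrite term.
rewrite -mulr_sumr.
have -> : \sum_(j < #|` A|) F (nth 0 A j) = mask_sum D ((l' - l)%:~R / N%:R : R).
  rewrite -(big_mkord predT (fun j => F (nth 0 A j))) -(big_nth 0 predT).
  rewrite big_imfset/=; last by move=> a b _ _ [].
  apply: eq_bigr => d _; rewrite -expiMn /F intrM; congr expi.
  by rewrite -[(Posz d)%:~R]/(d%:R); ring.
have [kk'|kk'] := eqVneq k k'; last first.
  rewrite orthB ?mulr0 ?mem_nth//.
  by apply/eqP; rewrite nth_uniq ?fset_uniq// eq_sym.
have D_neq0 : (#|` D|)%:R != 0 :> R by rewrite pnatr_eq0 cardfs_eq0.
rewrite /l' -kk' -/l.
have -> : mask_sum D ((l - l)%:~R / N%:R : R) = real_complex R (#|` D|)%:R.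
  rewrite subrr mul0r /mask_sum mulr0 expi0; under eq_bigr do rewrite expr1n.
  by rewrite big_const_seq count_predT iter_addr_0 rmorph_nat.
by rewrite /c -rmorphXn -rmorphM/= exprVn sqr_sqrtr ?ler0n// cardA mulVf.
Qed.

(* If Lambda missed the class of a + c p^e modulo p^(e+1), the integer a + c p^e
   could be added to it. *)
Lemma orthogonal_maximal_full (R : realType) (p : nat) (V : pred nat)
    (mu : probability (measurableTypeR R) R) (Lambda : set R)
    (a : int) (e : nat) (c : int) :
  (forall xi : R, fourier mu xi = 0 <->
    exists2 m, xi = m%:~R & exists2 e', V e' & exact_dvdz p e' m) ->
  orthogonal_maximal mu Lambda ->
  (forall l, Lambda l -> exists m : int, l = m%:~R) ->
  Lambda a%:~R -> V e ->
  exists2 b : int, Lambda b%:~R &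
    ((p ^ e.+1)%N%:Z %| b - (a + c * (p ^ e)%N%:Z))%Z.
Proof.
move=> mu0 [orthL maxL] intL La Ve; apply: contrapT => missing.
set x := a + c * (p ^ e)%N%:Z.
have x_sep b : Lambda b%:~R -> exists2 e', V e' & exact_dvdz p e' (x - b).
  move=> Lb; have npx : ~ ((p ^ e.+1)%N%:Z %| x - b)%Z.
    by rewrite -opprB rpredN => bx; apply: missing; exists b.
  have xbE : x - b = (a - b) + c * (p ^ e)%N%:Z by rewrite /x; ring.
  (* If p^e divides a - b, then x - b has valuation exactly e. Otherwise the valuation of a - b is
     below e and survives the shift by a multiple of p^e. *)
  have [ab|nab] := boolP ((p ^ e)%N%:Z %| a - b)%Z.
    by exists e => //; split=> //; rewrite xbE rpredD// dvdz_mull.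
  have a_ne_b : a%:~R <> b%:~R :> R.
    by move=> /intr_inj ab; rewrite ab subrr dvdz0 in nab.
  have /mu0[m] : fourier mu (a%:~R - b%:~R) = 0.
    by rewrite -Cintegral_efun; exact: orthL.
  rewrite -intrB => /intr_inj <- [e' Ve' e'ab]; exists e' => //.
  rewrite xbE; apply: exact_dvdz_add => //; apply: dvdz_mull.
  rewrite dvdzE/= dvdn_exp2l// ltnNge; apply/negP => ee'.
  by move/negP: nab; apply; apply: dvdz_pow ee' e'ab.1.
have LxE : Lambda `|` [set x%:~R] = Lambda.
  apply: maxL; first exact: subsetUl.
  move=> l l' Ll Ll' ll'; rewrite Cintegral_efun.
  case: Ll Ll' ll' => [Ll|->] [Ll'|->] ll'.
  - by rewrite -Cintegral_efun; exact: orthL.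
  - have [b lb] := intL _ Ll; subst l; apply/mu0.
    exists (b - x); first by rewrite intrB.
    have [e' ? ?] := x_sep _ Ll; exists e' => //.
    by rewrite -opprB; exact: exact_dvdzN.
  - have [b lb] := intL _ Ll'; subst l'; apply/mu0.
    by exists (x - b); [rewrite intrB|exact: x_sep].
  - by case: ll'.
apply: missing; exists x; last by rewrite subrr dvdz0.
by rewrite -LxE; right.
Qed.

(** * Digit sets of a maximal set of frequencies *)

Theorem theorem3p10 (R : realType) (p alpha N : nat) (D : {fset nat})
    (mu : probability (measurableTypeR R) R) (Lambda : set R)
    (n : nat) (d : 'I_n -> int)
    (p_prime : prime p) (alpha_ge1 : (1 <= alpha)%N)
    (N_def : N = (p ^ alpha)%N)
    (D_neq0 : D != fset0)
    (D_inj_mod : forall a b : nat, a \in D -> b \in D ->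
       a = b %[mod N] -> a = b)
    (mu_cantor : is_cantor_measure N D mu)
    (D_prod : mask_poly D =
       \big[*%R/1]_(t \in cyclotomic_exponents p D) 'Phi_(p ^ t))
    (Lambda_max : orthogonal_maximal mu Lambda)
    (Lambda0 : Lambda 0)
    (d_digit : forall j : 'I_n, 0 <= d j < N%:Z)
    (Lambda_n_neq0 : frequencies_with_digits N Lambda d !=set0) :
  let L := digit N n @` frequencies_with_digits N Lambda d in
  [/\ finite_set L,
      #|` fset_set L| = #|` D| &
      hadamard_triple R N [fset Posz a | a in D]%fset (fset_set L)].
Proof.
move=> L; have p_gt1 := prime_gt1 p_prime.
have N_gt0 : (0 < N)%N by rewrite N_def expn_gt0 prime_gt0.
pose V := zero_exponent p alpha D.
have mu0 (xi : R) : fourier mu xi = 0 <->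
    exists2 m, xi = m%:~R & exists2 e, V e & exact_dvdz p e m.
  by apply: fourier_cantor_eq0; rewrite -?N_def.
have [orthL _] := Lambda_max.
have L_sep (l l' : R) : Lambda l -> Lambda l' -> l <> l' -> exists2 m : int,
    l - l' = m%:~R & exists2 e, V e & exact_dvdz p e m.
  by move=> Ll Ll' ll'; apply/mu0; rewrite -Cintegral_efun; exact: orthL.
(* Since 0 is in [Lambda], a nonzero frequency is itself a zero of the transform, hence an
   integer. *)
have L_int (l : R) : Lambda l -> exists m : int, l = m%:~R.
  move=> Ll; have [->|/eqP l0] := eqVneq l 0; first by exists 0.
  by have [m] := L_sep _ _ Ll Lambda0 l0; rewrite subr0 => lm _; exists m.
pose A := [set k : int | Lambda k%:~R].
have A_sep a b : A a -> A b -> a <> b ->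
    exists2 e, V e & exact_dvdz p e (a - b).
  move=> Aa Ab ab; have [|m] := L_sep _ _ Aa Ab; first by move/intr_inj.
  by rewrite -intrB => /intr_inj <-.
have A_full a e c : A a -> V e ->
    exists2 b, A b & ((p ^ e.+1)%N%:Z %| b - (a + c * (p ^ e)%N%:Z))%Z.
  exact: orthogonal_maximal_full mu0 Lambda_max L_int.
have [a0 a0L] := Lambda_n_neq0.
have freqE := fun b => frequencies_with_digitsE b N_gt0 a0L.
have Nn : (N ^ n = p ^ (alpha * n))%N by rewrite N_def expnM.
have NnS : (N ^ n.+1 = p ^ (alpha * n + alpha))%N.
  by rewrite N_def -expnM mulnS addnC.
(* The n-th base-N digit occupies the alpha base-p levels starting at alpha n. *)
have [s [s_uniq s_size sA s_inj s_cov]] :=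
  exists_representatives p_gt1 A_sep A_full (alpha * n) alpha a0L.1.
have digit_eq (a b : int) : frequencies_with_digits N Lambda d a ->
    frequencies_with_digits N Lambda d b ->
    digit N n a = digit N n b <-> ((p ^ (alpha * n + alpha))%N%:Z %| a - b)%Z.
  move=> [_ da] [_ db]; rewrite -NnS -digits_eq_dvdz//.
  split=> [ab j|ab]; last exact: ab.
  rewrite ltnS leq_eqVlt => /predU1P[->//|jn].
  by rewrite (da (Ordinal jn)) (db (Ordinal jn)).
have s_freq x : x \in s -> frequencies_with_digits N Lambda d x.
  by move=> /sA[Ax xa0]; apply/freqE; rewrite Nn.
have LE : L = [set` [fset x in map (digit N n) s]%fset].
  apply/seteqP; split=> [_ [x xL <-]|l]/=.
    have [Lx] := (freqE x).1 xL; rewrite Nn => xa0.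
    have [y ys xy] := s_cov _ Lx xa0; rewrite inE; apply/mapP; exists y => //.
    exact: (digit_eq _ _ xL (s_freq _ ys)).2.
  by rewrite inE => /mapP[x xs ->]; exists x => //; exact: s_freq.
have L_card : #|` fset_set L| = #|` D|.
  rewrite LE set_fsetK card_fseq undup_id ?size_map ?s_size; last first.
    rewrite map_inj_in_uniq// => x y xs ys /digit_eq xy.
    by apply: s_inj => //; apply: xy; exact: s_freq.
  rewrite (@card_digit_set p alpha D) -?N_def//; congr (_ ^ _)%N.
  (* Periodicity of [V] modulo alpha moves the count to the first alpha levels. *)
  by apply: eq_count => v; exact: zero_exponent_addM.
have L_fin : finite_set L by rewrite LE; exact: finite_fset.
split=> //; apply: hadamard_tripleP => // l l'.
rewrite !in_fset_set// !inE => -[a aL <-] [b bL <-] ab.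
have a_ne_b : a <> b by move=> ab'; apply: ab; rewrite ab'.
have [e Ve [eab neab]] := A_sep _ _ aL.1 bL.1 a_ne_b.
have [da db] := (aL.2, bL.2).
have tail_ab := @base_tail_diff N n a b.
have {}tail_ab : a - b = (N ^ n)%N%:Z * (base_tail N n a - base_tail N n b).
  by apply: tail_ab => j jn; rewrite (da (Ordinal jn)) (db (Ordinal jn)).
(* The first n digits of [a] and [b] agree and the n-th ones differ, which traps the valuation of a
   - b among the levels of the n-th digit. *)
have e_ge : (alpha * n <= e)%N.
  rewrite leqNgt; apply/negP => e_lt; apply: neab; apply: (dvdz_pow e_lt).
  by rewrite tail_ab Nn dvdz_mulr.
have e_lt : (e < alpha * n + alpha)%N.
  rewrite ltnNge; apply/negP => le_e; apply: ab.
  by apply: (digit_eq _ _ aL bL).2; exact: dvdz_pow le_e eab.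
pose v := (e - alpha * n)%N; have eE : e = (alpha * n + v)%N by rewrite subnKC.
have va : (v < alpha)%N by rewrite -(ltn_add2l (alpha * n)) -eE.
(* After division by N^n, the n-th digits differ by the same amount as the tails modulo N = p^alpha,
   so the digit difference has valuation e - alpha n. *)
have dvd_digit w : (w <= alpha)%N ->
    ((p ^ w)%N%:Z %| digit N n a - digit N n b)%Z =
    ((p ^ (alpha * n + w))%N%:Z %| a - b)%Z.
  move=> w_le; rewrite tail_ab Nn expnD PoszM.
  rewrite dvdz_mul2l -?lt0n ?expn_gt0 ?prime_gt0//.
  have -> : base_tail N n a - base_tail N n b = digit N n a - digit N n b
      + N%:Z * (base_tail N n.+1 a - base_tail N n.+1 b).
    by rewrite (base_tailE N n a) (base_tailE N n b); ring.
  rewrite [RHS]rpredDr// dvdz_mulr// N_def dvdzE/=.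
  exact: dvdn_exp2l.
(* Writing N as N^1 selects level k = 0 of the zero criterion. *)
rewrite N_def -[X in _ / X]expr1.
apply/(mask_sum_div_eq0 p_prime D_neq0); rewrite -?N_def//.
exists (digit N n a - digit N n b), v; split=> //.
  by rewrite -(zero_exponent_addM p alpha D n v) -eE.
by rewrite muln0 add0n; split; rewrite dvd_digit ?addnS -?eE// ltnW.
Qed.
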